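(* Let $q$ be a prime power, $n\ge 1$ an integer, and let $B_n\subset\mathbb{P}^n$ be the curve over $\mathbb{F}_q$ defined as the image of $$\Phi_n:\mathbb{P}^1\to\mathbb{P}^n,\qquad (s,t)\mapsto(\tilde\varphi_0(s,t),\tilde\varphi_1(s,t),\dots,\tilde\varphi_n(s,t)),$$ with $\tilde\varphi_k$ as defined in the context. Then the number $N_q(B_n)$ of $\mathbb{F}_q$-points of $B_n$ is $$N_q(B_n)=\frac{1}{n}q^n+\sum_{\substack{d\mid n\\ d\neq n}}\frac{1}{d}\left(\prod_{\substack{l\text{ prime}\\ l\mid \frac{n}{d}}}\left(1-\frac{1}{l}\right)\right)q^d+1 .$$
   Context: For variables $X_0,\dots,X_{n-1},Y_0,\dots,Y_{n-1}$ and $0\le k\le n$, put $$\tilde\sigma_k(X_0,\dots,X_{n-1};Y_0,\dots,Y_{n-1})=\sum X_{i_1}\cdots X_{i_k}Y_{j_1}\cdots Y_{j_{n-k}},$$ the sum being over all $i_1<\dots<i_k$ and $j_1<\dots<j_{n-k}$ with $\{i_1,\dots,i_k,j_1,\dots,j_{n-k}\}=\{0,\dots,n-1\}$. Define the homogeneous polynomials of degree $q^{n-1}+q^{n-2}+\dots+1$ $$\tilde\varphi_k(s,t)=\tilde\sigma_k(s,s^q,\dots,s^{q^{n-1}};t,t^q,\dots,t^{q^{n-1}}),\qquad k=0,\dots,n.$$ $\mathbb{P}^1,\mathbb{P}^n$ are projective spaces over an algebraic closure $\overline{\mathbb{F}}_q$ of $\mathbb{F}_q$, and $N_q(B_n)$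 is the number of points of $B_n$ lying in $\mathbb{P}^n(\mathbb{F}_q)$. *)

(* Defs.v *)
From HB Require Import structures.
From mathcomp Require Import all_boot all_order all_algebra.

Set Implicit Arguments.
Unset Strict Implicit.
Unset Printing Implicit Defensive.

Import GRing.Theory.
Local Open Scope ring_scope.

Section Forms.
Variable R : comNzRingType.

(* The conditions on (I, J) force J to be the complement of I. *)
Definition sigma_tilde (n k : nat) (X Y : 'I_n -> R) : R :=
  \sum_(IJ : {set 'I_n} * {set 'I_n} |
        [&& #|IJ.1| == k, #|IJ.2| == (n - k)%N & IJ.1 :|: IJ.2 == [set: 'I_n]])
    (\prod_(i in IJ.1) X i) * (\prod_(j in IJ.2) Y j).

Definition phi_tilde (q n k : nat) (s t : R) : R :=
  sigma_tilde k (fun i : 'I_n => s ^+ (q ^ i)) (fun i : 'I_n => t ^+ (q ^ i)).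

Lemma phi_tilde0 q n s t : phi_tilde q n 0 s t = \prod_(i < n) t ^+ (q ^ i).
Proof.
rewrite /phi_tilde /sigma_tilde (big_pred1 (set0, [set: 'I_n])) /=.
  rewrite big_set0 mul1r; apply: eq_bigl => i; exact: in_setT.
move=> [I J] /=; rewrite cards_eq0 subn0 xpair_eqE.
case: eqP => //= ->; rewrite set0U.
by case: (J =P [set: 'I_n]) => [->|]; rewrite ?andbF // cardsT card_ord eqxx.
Qed.

Lemma phi_tilden q n s t : phi_tilde q n n s t = \prod_(i < n) s ^+ (q ^ i).
Proof.
rewrite /phi_tilde /sigma_tilde (big_pred1 ([set: 'I_n], set0)) /=.
  rewrite big_set0 mulr1; apply: eq_bigl => i; exact: in_setT.
move=> [I J] /=; rewrite subnn cards_eq0 xpair_eqE [RHS]andbC.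
case: (J =P _) => [->|]; rewrite ?andbF //= setU0.
by case: (I =P [set: 'I_n]) => [->|]; rewrite ?andbF // cardsT card_ord eqxx.
Qed.

Lemma phi_tildeZ q n k c s t : (k <= n)%N ->
  phi_tilde q n k (c * s) (c * t)
  = c ^+ (\sum_(i < n) q ^ i)%N * phi_tilde q n k s t.
Proof.
move=> le_kn; rewrite /phi_tilde /sigma_tilde big_distrr /=.
apply: eq_bigr => -[I J] /= /and3P[/eqP cI /eqP cJ /eqP IJ].
have cIJ0 : I :&: J = set0.
  apply/eqP; rewrite -cards_eq0 cardsI IJ cardsT card_ord cI cJ.
  by rewrite subnKC // subnn.
under eq_bigr do rewrite exprMn.
under [X in _ * X]eq_bigr do rewrite exprMn.
rewrite !big_split /= mulrACA; congr (_ * _).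
rewrite -bigU /=; last by rewrite -setI_eq0 cIJ0.
rewrite -expr_sum; congr (_ ^+ _).
by apply: eq_bigl => i; rewrite !inE -in_setU IJ inE.
Qed.

End Forms.

(* Projective n-space over K: the lines through the origin of K^(n+1). *)
Record projspace (K : fieldType) (n : nat) := ProjSpace {
  pline :> {vspace 'rV[K]_n.+1};
  _ : \dim pline == 1%N
}.

HB.instance Definition _ (K : fieldType) (n : nat) :=
  [isSub for @pline K n].
HB.instance Definition _ (K : fieldType) (n : nat) :=
  [Choice of projspace K n by <:].

Section ProjectivePoints.
Variables (K : fieldType) (n : nat).
Implicit Types (x : projspace K n) (v : 'rV[K]_n.+1).

Fact pcoord_subproof v (v_nz : v != 0) : \dim <[v]>%VS == 1%N.
Proof. by rewrite dim_vline v_nz. Qed.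

(* The point [v_0 : ... : v_n] with homogeneous coordinates v. *)
Definition ppoint v (v_nz : v != 0) : projspace K n :=
  ProjSpace (pcoord_subproof v_nz).

(* Some choice of homogeneous coordinates of x. *)
Definition pcoord x : 'rV[K]_n.+1 := vpick x.

Lemma pcoord_neq0 x : pcoord x != 0.
Proof. by rewrite /pcoord vpick0 -dimv_eq0 (eqP (valP x)). Qed.

Lemma ppointE v w (v_nz : v != 0) (w_nz : w != 0) c :
  w = c *: v -> ppoint w_nz = ppoint v_nz.
Proof.
move=> wE; apply: val_inj; apply/eqP; rewrite /= eqEdim !dim_vline v_nz w_nz.
by rewrite leqnn andbT wE -memvE; apply/vlineP; exists c.
Qed.

Lemma pcoordK x : ppoint (pcoord_neq0 x) = x.
Proof.
apply: val_inj; apply/eqP; rewrite /= eqEdim dim_vline pcoord_neq0.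
by rewrite (eqP (valP x)) leqnn andbT -memvE memv_pick.
Qed.

End ProjectivePoints.

Section ProjectiveMaps.
Variables (K L : fieldType) (m n : nat).
Variables (f : 'rV[K]_m.+1 -> 'rV[L]_n.+1).
Hypothesis f_nz : forall v, v != 0 -> f v != 0.

(* The map [v] |-> [f v]; by projmapE it does not depend on the choice of
   homogeneous coordinates when f sends proportional vectors to proportional
   vectors. *)
Definition projmap (x : projspace K m) : projspace L n :=
  ppoint (f_nz (pcoord_neq0 x)).

Lemma projmapE (v : 'rV[K]_m.+1) (v_nz : v != 0) :
    (forall c w, exists d, f (c *: w) = d *: f w) ->
  projmap (ppoint v_nz) = ppoint (f_nz v_nz).
Proof.
move=> f_hom; have /vlineP[c pv] : pcoord (ppoint v_nz) \in <[v]>%VS.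
  exact: memv_pick.
have [d fd] := f_hom c v.
by apply: (@ppointE _ _ _ _ _ _ d); rewrite pv.
Qed.

End ProjectiveMaps.

Section BaseChange.
Variables (F L : fieldType) (iota : {rmorphism F -> L}) (n : nat).

Fact map_rV_neq0 (v : 'rV[F]_n.+1) : v != 0 -> map_mx iota v != 0.
Proof. by rewrite map_mx_eq0. Qed.

(* The inclusion P^n(F) -> P^n(L). *)
Definition pbase : projspace F n -> projspace L n := projmap map_rV_neq0.

Lemma pbaseE v (v_nz : v != 0) : pbase (ppoint v_nz) = ppoint (map_rV_neq0 v_nz).
Proof. by apply: projmapE => c w; exists (iota c); rewrite map_mxZ. Qed.

End BaseChange.

From mathcomp Require Import finmap.
From mathcomp Require Import boolp classical_sets functions cardinality.

Section Curve.
Variables (K : fieldType) (q n : nat).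

Definition Phi_vec (v : 'rV[K]_2) : 'rV[K]_n.+1 :=
  \row_(k < n.+1) phi_tilde q n k (v ord0 ord0) (v ord0 ord_max).

Fact Phi_vec_neq0 v : v != 0 -> Phi_vec v != 0.
Proof.
move=> v_nz; apply/eqP => /rowP Pv0.
have t0 : v ord0 ord_max = 0.
  apply/eqP; apply: contraT => t_nz; have /eqP := Pv0 ord0.
  rewrite !mxE phi_tilde0 prodf_seq_eq0 => /hasP[i _] /=.
  by rewrite expf_eq0 (negbTE t_nz) andbF.
have s0 : v ord0 ord0 = 0.
  apply/eqP; apply: contraT => s_nz; have /eqP := Pv0 ord_max.
  rewrite !mxE phi_tilden prodf_seq_eq0 => /hasP[i _] /=.
  by rewrite expf_eq0 (negbTE s_nz) andbF.
case/eqP: v_nz; apply/rowP => i; rewrite mxE.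
have [->|->] // : i = ord0 \/ i = ord_max.
by case: i => [[|[|//]] lti]; [left|right]; apply: val_inj.
Qed.

Definition Phi : projspace K 1 -> projspace K n := projmap Phi_vec_neq0.

Lemma PhiE v (v_nz : v != 0) : Phi (ppoint v_nz) = ppoint (Phi_vec_neq0 v_nz).
Proof.
apply: projmapE => c w; exists (c ^+ (\sum_(i < n) q ^ i)%N).
by apply/rowP => k; rewrite !mxE phi_tildeZ // -ltnS.
Qed.

Definition curveB : set (projspace K n) := range Phi.

End Curve.

Arguments curveB K q n : clear implicits.

Definition is_algebraic_closure (F : fieldType) (K : closedFieldType)
    (iota : {rmorphism F -> K}) : Prop :=
  forall x : K, algebraicOver iota x.

Section RationalPoints.
Variables (F : finFieldType) (K : fieldType) (iota : {rmorphism F -> K}).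
Variable n : nat.
Local Open Scope classical_set_scope.

Definition rational_points (B : set (projspace K n)) : set (projspace K n) :=
  B `&` range (pbase iota (n := n)).

Lemma finite_rational_points B : finite_set (rational_points B).
Proof.
apply: finite_setIr; apply: finite_image.
pose pt (u : {v : 'rV[F]_n.+1 | v != 0}) := ppoint (valP u).
apply: (@sub_finite_set _ _ (range pt)); last first.
  by apply: finite_image; apply: finite_finset.
move=> x _; exists (Sub (pcoord x) (pcoord_neq0 x)) => //.
by rewrite -[RHS]pcoordK; apply: val_inj.
Qed.

(* fset_set is meaningful here by finite_rational_points. *)
Definition num_rational_points (B : set (projspace K n)) : nat :=
  #|` fset_set (rational_points B)|%fset.

End RationalPoints.

(* Main.v *)
From mathcomp Require Import finmap boolp classical_sets cardinality.
Require Import Defs.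
From mathcomp Require Import all_boot all_order all_algebra.
From mathcomp Require Import all_fingroup all_field ring.

Set Implicit Arguments.
Unset Strict Implicit.
Unset Printing Implicit Defensive.

Import GRing.Theory Num.Theory.
Local Open Scope ring_scope.

(** The affine points (s : 1) of the line are sent to the elementary symmetric
    functions of s, s^q, ..., s^(q^(n-1)), that is, up to signs, to the
    coefficients of the monic polynomial
      Q_s = ('X - s) ('X - s^q) ... ('X - s^(q^(n-1)))
    ([prod_sigma_tilde], [frob_polyE]). Since the coordinate of index 0 of the
    image is 1, two affine points have the same image exactly when their
    polynomials agree, and the image is rational exactly when the coefficients
    of Q_s lie in the field with q elements, i.e., are fixed by x |-> x^q.
    Raising the coefficients of Q_s to the power q gives Q_(s^q), so
    rationality means Q_(s^q) = Q_s; these two products share all their factors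
    but one, 'X - s for the latter and 'X - s^(q^n) for the former, whence
    rationality means s^(q^n) = s ([frob_poly_fix]). For such s, the roots of
    Q_s are the Frobenius orbit of s, so the fibres of Phi over these points are
    the Frobenius orbits ([frob_poly_orbit]).

    The remaining point (1 : 0) contributes one more rational point, which no
    affine point reaches because its coordinate of index 0 vanishes. Hence the
    number of rational points is one plus the number of orbits of the Frobenius
    x |-> x^q, acting with n-th power the identity, on the q^n roots of
    'X^(q^n) - 'X. The i-th power of the Frobenius fixes those of its roots that
    are roots of 'X^(q^g) - 'X with g = gcd(i, n) ([expr_fix_gcdn]), so the
    orbit-counting lemma gives
      n * #orbits = \sum_(i < n) q^(gcd(i, n))
                  = \sum_(d | n) totient (n / d) * q^d
    and the Euler product of the totient puts this in the announced form. *)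

(** * The generating polynomial of the forms *)

(** The forms sigma_tilde are the coefficients of the binary form that is the
    product of the linear forms Y_i U - X_i V: expanding the product amounts to
    choosing the set I of factors from which X_i is taken, and Y_j is then taken
    on the complement. *)
Lemma prod_sigma_tilde (R : comNzRingType) n (X Y : 'I_n -> R) :
  \prod_(i < n) (Y i *: 'X - (X i)%:P) =
  \sum_(k < n.+1) ((-1) ^+ k * sigma_tilde k X Y) *: 'X^(n - k).
Proof.
under eq_bigr do rewrite addrC.
rewrite bigA_distr.
rewrite (partition_big (fun I : {set 'I_n} => inord #|I| : 'I_n.+1) predT) //=.
apply: eq_bigr => k _.
have cardE (I : {set 'I_n}) : (inord #|I| == k) = (#|I| == k :> nat).
  by rewrite -val_eqE /= inordK // ltnS -[X in (_ <= X)%N]card_ord max_card.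
rewrite (eq_bigl _ _ cardE) /sigma_tilde mulr_sumr scaler_suml.
rewrite [RHS](reindex_onto (fun I : {set 'I_n} => (I, ~: I)) fst) /=; last first.
  move=> [I J] /= /and3P[/eqP cI /eqP cJ /eqP IJ]; congr pair.
  apply/eqP; rewrite eqEcard; apply/andP; split; last first.
    by rewrite cJ -[X in (X - _)%N]card_ord -(cardsC I) cI addKn.
  by rewrite -setTD subDset IJ.
apply: eq_big => [I|I /eqP cI].
  rewrite eqxx andbT setUCr eqxx andbT.
  by case: eqP => //= <-; rewrite -[X in (X - _)%N]card_ord -(cardsC I) addKn eqxx.
have inI : \prod_(i in I) (if i \in I then - (X i)%:P else Y i *: 'X)
    = (-1)%:P ^+ k * (\prod_(i in I) X i)%:P.
  rewrite -cI -prodr_const rmorph_prod -big_split; apply: eq_bigr => i ->.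
  by rewrite /= polyCN mulN1r.
have ninI : \prod_(i | i \notin I) (if i \in I then - (X i)%:P else Y i *: 'X)
    = (\prod_(i in ~: I) Y i)%:P * 'X^(n - k).
  transitivity (\prod_(i | i \notin I) ((Y i)%:P * 'X)).
    by apply: eq_bigr => i /negbTE ->; rewrite mul_polyC.
  rewrite big_split /= -rmorph_prod; congr (_%:P * _).
    by apply: eq_bigl => i; rewrite inE.
  have -> : (n - k)%N = #|[predC I]|.
    by rewrite -[X in (X - _)%N]card_ord -(cardC I) cI addKn.
  exact: prodr_const.
rewrite (bigID (mem I)) /= inI ninI -mul_polyC !polyCM rmorphXn /=.
ring.
Qed.

(** Stated for a bare function f rather than for a bundled ring morphism because
    it is applied to x |-> x^q, whose additivity depends on the characteristic,
    as well as to the inclusion of fields. *)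
Lemma phi_tilde_map (R S : comNzRingType) (f : R -> S) q n k s t :
    {morph f : x y / x + y} -> {morph f : x y / x * y} -> f 0 = 0 -> f 1 = 1 ->
  f (phi_tilde q n k s t) = phi_tilde q n k (f s) (f t).
Proof.
move=> fD fM f0 f1; rewrite /phi_tilde /sigma_tilde (big_morph f fD f0).
have fX x m : f (x ^+ m) = f x ^+ m.
  by elim: m => [|m IHm]; rewrite ?expr0 // !exprS fM IHm.
apply: eq_bigr => IJ _; rewrite fM !(big_morph f fM f1).
by congr (_ * _); apply: eq_bigr => i _; rewrite fX.
Qed.

Lemma phi_tilde_frobenius (R : comNzRingType) q n k (s t : R) :
  [pchar R].-nat q ->
  phi_tilde q n k (s ^+ q) (t ^+ q) = phi_tilde q n k s t ^+ q.
Proof.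
move=> q_char; have q_gt0 : (0 < q)%N by case/andP: q_char.
apply/esym; rewrite (@phi_tilde_map _ _ (fun x => x ^+ q)) //.
- by move=> x y; apply: exprDn_pchar.
- by move=> x y; apply: exprMn.
- by rewrite expr0n; case: q q_gt0 {q_char}.
- exact: expr1n.
Qed.

Section Affine.
Variables (R : idomainType) (q n : nat).
Implicit Types s : R.

Definition frob_poly s : {poly R} := \prod_(i < n) ('X - (s ^+ (q ^ i))%:P).

Lemma frob_polyE s :
  frob_poly s = \sum_(k < n.+1) ((-1) ^+ k * phi_tilde q n k s 1) *: 'X^(n - k).
Proof.
rewrite -prod_sigma_tilde; apply: eq_bigr => i _.
by rewrite expr1n scale1r.
Qed.

Lemma coef_frob_poly s k : (k <= n)%N ->
  (frob_poly s)`_(n - k) = (-1) ^+ k * phi_tilde q n k s 1.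
Proof.
move=> le_kn; rewrite frob_polyE coef_sum (bigD1 (Ordinal (le_kn : k < n.+1)%N)) //=.
rewrite coefZ coefXn eqxx mulr1 big1 ?addr0 // => j.
rewrite -val_eqE /= => jk; rewrite coefZ coefXn; case: eqP; rewrite ?mulr0 // => e.
by case/eqP: jk; rewrite -(subKn le_kn) e subKn // -ltnS.
Qed.

Lemma frob_poly_eqP s s' :
  frob_poly s = frob_poly s' <->
  forall k, (k <= n)%N -> phi_tilde q n k s 1 = phi_tilde q n k s' 1.
Proof.
split=> [eqQ k le_kn|eqphi]; last first.
  by rewrite !frob_polyE; apply: eq_bigr => k _; rewrite eqphi // -ltnS.
by apply: (mulrI (unitrX k (unitrN1 _))); rewrite -!coef_frob_poly // eqQ.
Qed.

(** The n + 1 linear factors attached to s, s^q, ..., s^(q^n) can be grouped as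
    the first one times frob_poly (s^q), or as the last one times frob_poly s.
    Cancelling compares the two. *)
Lemma frob_poly_fix s : frob_poly (s ^+ q) = frob_poly s <-> s ^+ (q ^ n) = s.
Proof.
have shift : ('X - s%:P) * frob_poly (s ^+ q)
           = ('X - (s ^+ (q ^ n))%:P) * frob_poly s.
  rewrite [RHS]mulrC.
  transitivity (\prod_(i < n.+1) ('X - (s ^+ (q ^ i))%:P)); last first.
    by rewrite big_ord_recr.
  rewrite big_ord_recl expn0 expr1; congr (_ * _).
  by apply: eq_bigr => i _; rewrite -exprM -expnS.
have Q_neq0 : frob_poly s != 0.
  by apply/monic_neq0/monic_prod => i _; apply: monicXsubC.
split=> e; last by apply: (mulfI (monic_neq0 (monicXsubC s))); rewrite shift e.
move: shift; rewrite e => /(mulIf Q_neq0)/(congr1 (fun p : {poly R} => p.[s])).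
by rewrite !hornerXsubC subrr => /esym/eqP; rewrite subr_eq0 => /eqP<-.
Qed.

(** Equality of the polynomials makes s' a root of frob_poly s, which is split
    with roots the iterates of s; conversely, frob_poly_fix says that the
    polynomial does not change along the orbit. *)
Lemma frob_poly_orbit s s' : s ^+ (q ^ n) = s -> (0 < n)%N ->
  frob_poly s = frob_poly s' <-> exists2 i, (i < n)%N & s' = s ^+ (q ^ i).
Proof.
move=> s_fix n_gt0; split=> [eqQ|[i _ ->]].
  have: root (frob_poly s) s'.
    rewrite eqQ /root horner_prod (bigD1 (Ordinal n_gt0)) //= expn0 expr1.
    by rewrite hornerXsubC subrr mul0r.
  rewrite /root horner_prod prodf_seq_eq0 => /hasP[i _] /=.
  by rewrite hornerXsubC subr_eq0 => /eqP->; exists i.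
elim: i => [|i ->]; first by rewrite expr1.
rewrite expnSr exprM; apply/esym/frob_poly_fix.
by rewrite -!exprM mulnC exprM s_fix.
Qed.

End Affine.

(** * Fixed points of the powers of the Frobenius *)

(** The polynomial 'X^#|F| - 'X splits over F, so it has no root in L outside
    the image of F. *)
Lemma frobenius_fixed_image (F : finFieldType) (L : fieldType)
    (iota : {rmorphism F -> L}) x :
  x ^+ #|F| = x -> exists a, x = iota a.
Proof.
move=> x_fix; have := congr1 (fun p => (map_poly iota p).[x]) (finField_genPoly F).
rewrite /= rmorphB /= map_polyXn map_polyX hornerD hornerN hornerXn hornerX x_fix subrr.
rewrite rmorph_prod horner_prod => /esym/eqP; rewrite prodf_seq_eq0 => /hasP[a _] /=.
rewrite rmorphB /= map_polyX map_polyC hornerXsubC subr_eq0 => /eqP->.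
by exists a.
Qed.

(** The derivative of 'X^m - 'X is -1 as m = 0 in K, so the polynomial is
    separable. *)
Lemma XnsubX_roots (K : closedFieldType) m : (1 < m)%N -> m%:R = 0 :> K ->
  exists rs : seq K, [/\ uniq rs, size rs = m & forall x, (x \in rs) = (x ^+ m == x)].
Proof.
move=> m_gt1 m0; pose p : {poly K} := 'X^m - 'X.
have szp : size p = m.+1.
  by rewrite size_polyDl ?size_polyXn // size_polyN size_polyX.
have p_monic : lead_coef p = 1.
  by rewrite lead_coefDl ?lead_coefXn // size_polyN size_polyX size_polyXn.
have [rs pE] := closed_field_poly_normal p.
rewrite p_monic scale1r in pE.
exists rs; split=> [||x].
- rewrite -separable_prod_XsubC -pE unlock derivB derivXn derivX -mulr_natr.
  by rewrite -polyC_natr m0 mulr0 sub0r -scaleN1r coprimepZr ?oppr_eq0 ?oner_eq0 ?coprimep1.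
- by move: szp; rewrite pE size_prod_XsubC => -[].
- by rewrite -root_prod_XsubC -pE /root !hornerE subr_eq0.
Qed.

Lemma expr_fix_dvd (R : nzRingType) (x : R) q a b :
  (a %| b)%N -> x ^+ (q ^ a) = x -> x ^+ (q ^ b) = x.
Proof.
move=> /dvdnP[k ->] xa.
by elim: k => [|k IHk] //; rewrite mulSn expnD exprM xa.
Qed.

(** The exponents i such that x^(q^i) = x behave like the multiples of a period,
    by a Bezout relation of the form gcd(i, n) + a n = b i. *)
Lemma expr_fix_gcdn (R : nzRingType) (x : R) q i n :
  x ^+ (q ^ gcdn i n) = x <-> x ^+ (q ^ i) = x /\ x ^+ (q ^ n) = x.
Proof.
split=> [xg|[xi xn]].
  by split; apply: expr_fix_dvd xg; rewrite ?dvdn_gcdl ?dvdn_gcdr.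
case: i xi => [|i] xi; first by rewrite gcd0n.
have [a _ ia] := Bezoutl n (ltn0Sn i).
rewrite -{1}(expr_fix_dvd (dvdn_mull a (dvdnn n)) xn) -exprM -expnD addnC.
exact: expr_fix_dvd ia xi.
Qed.

(** * The images of the points of the line *)

Lemma ppoint_eqP (K : fieldType) n (v w : 'rV[K]_n.+1) (v_nz : v != 0) (w_nz : w != 0) :
  ppoint v_nz = ppoint w_nz <-> exists c, w = c *: v.
Proof.
split=> [e|[c wE]]; last exact/esym/(ppointE _ _ wE).
have : w \in pline (ppoint v_nz) by rewrite e /= memv_line.
by case/vlineP=> c ->; exists c.
Qed.

Section Points.
Variable L : fieldType.

Definition pt_vec (s t : L) : 'rV[L]_2 := \row_i (if i == ord0 then s else t).

Fact affine_neq0 s : pt_vec s 1 != 0.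
Proof. by apply/eqP=> /rowP/(_ ord_max)/eqP; rewrite !mxE oner_eq0. Qed.

Fact infty_neq0 : pt_vec 1 0 != 0.
Proof. by apply/eqP=> /rowP/(_ ord0)/eqP; rewrite !mxE oner_eq0. Qed.

Definition affine_pt s := ppoint (affine_neq0 s).
Definition infty_pt := ppoint infty_neq0.

Lemma projline_cases (x : projspace L 1) : x = infty_pt \/ exists s, x = affine_pt s.
Proof.
rewrite -[x]pcoordK; move: (pcoord x) (pcoord_neq0 x) => v v_nz.
have vE : v = pt_vec (v ord0 ord0) (v ord0 ord_max).
  apply/rowP=> i; rewrite !mxE.
  by case: i => [[|[|//]] lti]; congr (v _ _); apply: val_inj.
have [t0|t_nz] := eqVneq (v ord0 ord_max) 0; [left | right].
  apply: (@ppointE _ _ _ _ _ _ (v ord0 ord0)); rewrite {1}vE t0.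
  by apply/rowP=> i; rewrite !mxE; case: ifP; rewrite ?mulr1 ?mulr0.
exists (v ord0 ord0 / v ord0 ord_max).
apply: (@ppointE _ _ _ _ _ _ (v ord0 ord_max)); rewrite {1}vE.
by apply/rowP=> i; rewrite !mxE; case: ifP; rewrite ?mulr1 // mulrC divfK.
Qed.

Variables q n : nat.

Lemma Phi_vecE s t k :
  Phi_vec q n (pt_vec s t) ord0 k = phi_tilde q n k s t.
Proof. by rewrite !mxE. Qed.

Lemma Phi_affine_coord0 s : Phi_vec q n (pt_vec s 1) ord0 ord0 = 1.
Proof. by rewrite Phi_vecE phi_tilde0 big1 // => i _; rewrite expr1n. Qed.

Lemma Phi_affine_eqP s s' :
  Phi q n (affine_pt s) = Phi q n (affine_pt s') <-> frob_poly q n s = frob_poly q n s'.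
Proof.
rewrite !PhiE ppoint_eqP frob_poly_eqP; split=> [[c e] k le_kn | e].
  have c1 : c = 1.
    by move/rowP/(_ ord0): e; rewrite [RHS]mxE !Phi_affine_coord0 mulr1.
  have /rowP/(_ (Ordinal (le_kn : k < n.+1)%N)) := e.
  by rewrite c1 scale1r !Phi_vecE.
by exists 1; rewrite scale1r; apply/rowP=> k; rewrite !Phi_vecE e // -ltnS.
Qed.

Lemma Phi_infty_neq s : (0 < n)%N -> Phi q n (affine_pt s) <> Phi q n infty_pt.
Proof.
move=> n_gt0; rewrite !PhiE => /esym/ppoint_eqP[c] /rowP/(_ ord0).
rewrite [RHS]mxE Phi_affine_coord0 Phi_vecE phi_tilde0 (bigD1 (Ordinal n_gt0)) //=.
by rewrite expr0n /= mul0r mulr0 => /eqP; rewrite oner_eq0.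
Qed.

End Points.

Section Rationality.
Variables (F : finFieldType) (L : fieldType) (iota : {rmorphism F -> L}) (n : nat).
Let q := #|F|.

Lemma card_pchar_nat : [pchar L].-nat q.
Proof.
have [p _ charFp] := finPcharP F.
rewrite /q (card_pprimeChar charFp) pnatX; apply/orP; left.
rewrite pnatE ?(pcharf_prime charFp) //.
exact: (rmorph_pchar iota).
Qed.

Lemma card_natr0 : q%:R = 0 :> L.
Proof.
have [p p_pr charFp] := finPcharP F; rewrite /q (card_pprimeChar charFp).
have := pcharf0 (rmorph_pchar iota charFp); rewrite natrX => ->.
rewrite expr0n; case: eqP => // l0.
by have := finNzRing_gt1 F; rewrite (card_pprimeChar charFp) l0.
Qed.

(** The point (1 : 0) is defined over F, and Phi commutes with the extension of
    scalars because its coordinates have integer coefficients. *)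
Lemma Phi_infty_rational : range (pbase iota (n := n)) (Phi q n (infty_pt L)).
Proof.
exists (Phi q n (infty_pt F)) => //; rewrite !PhiE pbaseE.
apply/ppoint_eqP; exists 1; rewrite scale1r; apply/rowP => k.
rewrite Phi_vecE [RHS]mxE Phi_vecE.
rewrite (phi_tilde_map _ _ _ _ _ (rmorphD iota) (rmorphM iota)).
- by rewrite rmorph0 rmorph1.
- exact: rmorph0.
- exact: rmorph1.
Qed.

(** The coordinate of index 0 being 1, the image is rational if and only if all
    its coordinates lie in iota(F), i.e., are fixed by x |-> x^q. Since the forms
    commute with this map, this says that s and s^q have the same coordinates. *)
Lemma Phi_affine_rational s :
  range (pbase iota (n := n)) (Phi q n (affine_pt s)) <-> s ^+ (q ^ n) = s.
Proof.
rewrite -frob_poly_fix frob_poly_eqP.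
have frobE k : phi_tilde q n k (s ^+ q) 1 = phi_tilde q n k s 1 ^+ q.
  by rewrite -phi_tilde_frobenius ?card_pchar_nat // expr1n.
split=> [[x _ xE] k le_kn | fix_k].
  move: xE; rewrite -[x]pcoordK; move: (pcoord x) (pcoord_neq0 x) => w w_nz.
  rewrite pbaseE PhiE => /esym/ppoint_eqP[c e].
  have c0 : iota (w ord0 ord0) = c.
    by move/rowP/(_ ord0): e; rewrite [LHS]mxE [RHS]mxE Phi_affine_coord0 mulr1.
  have c_nz : c != 0.
    apply: contraNneq w_nz => c0'; rewrite -(map_mx_eq0 iota) e c0'.
    by rewrite scale0r.
  rewrite frobE; have -> : phi_tilde q n k s 1 = iota (w ord0 (inord k) / w ord0 ord0).
    have /rowP/(_ (inord k)) := e; rewrite [LHS]mxE [RHS]mxE Phi_vecE inordK // => wE.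
    by rewrite fmorph_div c0 wE mulrC mulKf.
  by rewrite -rmorphXn expf_card.
have rat_k (k : 'I_n.+1) : exists a, phi_tilde q n k s 1 = iota a.
  by apply: frobenius_fixed_image; rewrite -frobE fix_k // -ltnS.
have [w wE] := choice rat_k.
have mapE : map_mx iota (\row_k w k) = Phi_vec q n (pt_vec s 1).
  by apply/rowP=> k; rewrite Phi_vecE !mxE wE.
have w_nz : \row_k w k != 0.
  by rewrite -(map_mx_eq0 iota) mapE Phi_vec_neq0 // affine_neq0.
exists (ppoint w_nz) => //; rewrite pbaseE PhiE.
by apply/ppoint_eqP; exists 1; rewrite scale1r mapE.
Qed.

End Rationality.

(** * Counting orbits *)

Lemma iter_mod (T : Type) (f : T -> T) n x m :
  iter n f x = x -> iter (m %% n) f x = iter m f x.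
Proof.
move=> fnx; rewrite {2}(divn_eq m n) addnC iterD; congr iter.
by elim: (m %/ n)%N => // k IHk; rewrite mulSn addnC iterD fnx.
Qed.

(** Both images are in bijection with the quotient of T by the common kernel of
    h and k; the map r chooses representatives of it. *)
Lemma card_imfset_ker (T V : finType) (U : choiceType) (h : T -> U) (k : T -> V) :
    (forall x y, h x = h y <-> k x = k y) ->
  #|` [fset h x | x in T]%fset| = #|[set k x | x in T]|.
Proof.
move=> hk; pose r x := odflt x [pick y | k y == k x].
have kr x : k (r x) = k x.
  by rewrite /r; case: pickP => [y /eqP|/(_ x)]; rewrite ?eqxx.
have r_inj : {in [set r x | x in T] &, injective k}.
  move=> _ _ /imsetP[x _ ->] /imsetP[y _ ->]; rewrite !kr /r => ->.
  by case: pickP => // /(_ y); rewrite eqxx.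
have -> : [set k x | x in T] = k @: (r @: T).
  by rewrite -imset_comp; apply: eq_imset => x; rewrite /= kr.
rewrite (card_in_imset r_inj).
have -> : [fset h x | x in T]%fset = [fset h x | x in [set r x | x in T]]%fset.
  apply/fsetP=> u; apply/imfsetP/imfsetP=> /= -[x xT ->].
    by exists (r x); [exact: imset_f | exact/hk].
  by exists x.
rewrite card_in_imfset; last by move=> x y xR yR /hk; exact: r_inj.
rewrite cardE; apply/perm_size/uniq_perm => [||x]; rewrite ?enum_uniq //.
Qed.

(** The orbit-counting lemma (Cauchy-Frobenius) for the cyclic group of order n
    acting through the iterates of f. The orbits are presented as the values of
    a function h whose fibres they are, which allows the map of the curve itself
    to enumerate the orbits of the Frobenius. *)
Lemma sum_card_fix_iter (T : finType) (U : choiceType) (f : T -> T) (h : T -> U) n :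
    (0 < n)%N -> (forall x, iter n f x = x) ->
    (forall x y, h x = h y <-> exists2 i, (i < n)%N & y = iter i f x) ->
  (\sum_(i < n) #|[set x | iter i f x == x]|)%N
    = (#|` [fset h x | x in T]%fset| * n)%N.
Proof.
case: n => // n _ fn hP.
have act1 : (fun x (i : 'I_n.+1) => iter i f x)^~ 1%g =1 id by [].
have actM x : act_morph (fun x (i : 'I_n.+1) => iter i f x) x.
  by move=> i j; rewrite /= iter_mod // addnC iterD.
pose to : {action 'I_n.+1 &-> T} := TotalAction act1 actM.
have orbE x y : h x = h y <-> orbit to [set: 'I_n.+1] x = orbit to [set: 'I_n.+1] y.
  rewrite hP; split=> [[i ltin yE]|/esym/orbit_eqP/orbitP[i _ <-]]; last first.
    by exists i.
  by apply/esym/orbit_eqP/orbitP; exists (Ordinal ltin).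
have := @Frobenius_Cauchy _ _ _ to [set: 'I_n.+1]%G [set: T].
rewrite /= cardsT card_ord => FC.
transitivity (\sum_(i in [set: 'I_n.+1]) #|'Fix_([set: T] | to)[i]%g|)%N.
  apply: eq_big => [i|i _]; first by rewrite inE.
  by apply: eq_card => x; rewrite !inE /= sub1set inE.
rewrite FC; last by apply/actsP=> i _ x; rewrite !inE.
congr (_ * _)%N; rewrite (card_imfset_ker orbE).
by apply: eq_card => O; apply/imsetP/imsetP=> -[x _ ->]; exists x.
Qed.

(** * Sums over greatest common divisors *)

(** The i < n with gcd(i, n) = d are the j * d with j < n / d and j prime to
    n / d. *)
Lemma card_gcdn_eq n d : (0 < n)%N -> (d %| n)%N ->
  #|[set i : 'I_n | gcdn i n == d]| = totient (n %/ d).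
Proof.
move=> n_gt0 d_n; have d_gt0 := dvdn_gt0 n_gt0 d_n.
rewrite totient_count_coprime big_mkord -sum1dep_card.
have [m nE] : exists m, n = (m * d)%N by case/dvdnP: d_n => m; exists m.
move: n_gt0 d_n; rewrite {}nE => n_gt0 d_n; rewrite mulnK //.
have m_gt0 : (0 < m)%N by case: m n_gt0 {d_n}.
have up (j : 'I_m) : (j * d < m * d)%N by rewrite ltn_pmul2r.
have dn (i : 'I_(m * d)) : (i %/ d < m)%N by rewrite ltn_divLR.
rewrite (reindex_onto (fun j => Ordinal (up j)) (fun i => Ordinal (dn i))).
  rewrite [RHS](eq_bigr (fun j : 'I_m => if coprime m j then 1 else 0)%N); last first.
    by move=> j _; case: coprime.
  rewrite -big_mkcond; apply: eq_bigl => j.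
  rewrite -muln_gcdl -[X in _ == X]mul1n eqn_pmul2r // gcdnC /coprime.
  by rewrite -val_eqE /= mulnK // eqxx andbT.
by move=> i /eqP dE; apply: val_inj; rewrite /= divnK // -[X in (X %| _)%N]dE dvdn_gcdl.
Qed.

Lemma sum_exp_gcdn q n : (0 < n)%N ->
  (\sum_(i < n) q ^ gcdn i n)%N = (\sum_(d <- divisors n) totient (n %/ d) * q ^ d)%N.
Proof.
move=> n_gt0.
have expE (i : 'I_n) : (q ^ gcdn i n = \sum_(d <- divisors n | d == gcdn i n) q ^ d)%N.
  rewrite -big_filter filter_pred1_uniq ?big_seq1 ?divisors_uniq //.
  by rewrite -dvdn_divisors ?dvdn_gcdr.
rewrite (eq_bigr _ (fun i _ => expE i)).
rewrite (exchange_big_dep predT) //=.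
rewrite !big_seq; apply: eq_bigr => d; rewrite -dvdn_divisors // => d_n.
rewrite sum_nat_const -(card_gcdn_eq n_gt0 d_n) cardsE; congr (_ * _)%N.
by apply: eq_card => i; exact: eq_sym.
Qed.

Lemma totient_prod n : (0 < n)%N ->
  (totient n)%:R = n%:R * \prod_(l <- primes n) (1 - l%:R^-1) :> rat.
Proof.
move=> n_gt0.
have nE : n%:R = \prod_(l <- primes n) (l ^ logn l n)%:R :> rat.
  rewrite {1}(prod_prime_decomp n_gt0) prime_decompE.
  by rewrite big_map /= natr_prod.
rewrite totientE // nE natr_prod -big_split /=; apply: eq_big_seq => l.
rewrite mem_primes => /and3P[l_prime _ l_n].
have l_gt0 := prime_gt0 l_prime.
have : (0 < logn l n)%N by rewrite logn_gt0 mem_primes l_prime n_gt0.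
case: (logn l n) => // k _ /=; rewrite expnS !natrM -subn1 natrB //.
by rewrite mulrBr mulr1 mulrAC divff ?pnatr_eq0 ?lt0n_neq0 // mul1r mulrBl mul1r.
Qed.

(** * The number of rational points *)

(** The points in the image of the affine line are the Frobenius orbits in the
    set T of roots of 'X^(q^n) - 'X, counted by sum_card_fix_iter; the first
    summand n accounts for the point (1 : 0). *)
Lemma num_rational_points_curveB (F : finFieldType) (K : closedFieldType)
    (iota : {rmorphism F -> K}) n : (0 < n)%N ->
  (num_rational_points iota (curveB K #|F| n) * n)%N
    = (n + \sum_(i < n) #|F| ^ gcdn i n)%N.
Proof.
move=> n_gt0; set q := #|F|.
have q_gt1 : (1 < q)%N := finNzRing_gt1 F.
have roots_fix g : (0 < g)%N ->
  exists rs : seq K, [/\ uniq rs, size rs = (q ^ g)%N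
                       & forall x, (x \in rs) = (x ^+ (q ^ g) == x)].
  case: g => // g _; apply: XnsubX_roots.
    by rewrite -(exp1n g.+1) ltn_exp2r.
  by rewrite natrX (card_natr0 iota) expr0n.
have [rs [rs_uniq _ rsP]] := roots_fix n n_gt0.
pose T : finType := seq_sub rs.
have T_fix (x : T) : ssval x ^+ (q ^ n) = ssval x.
  by apply/eqP; rewrite -rsP ssvalP.
have frobT (x : T) : ssval x ^+ q \in rs.
  by rewrite rsP -!exprM mulnC exprM T_fix.
pose f (x : T) : T := SeqSub (frobT x).
have iter_f i (x : T) : ssval (iter i f x) = ssval x ^+ (q ^ i).
  by elim: i => [|i IHi] //=; rewrite IHi -exprM -expnSr.
have iter_f_eq i (x y : T) : y = iter i f x <-> ssval y = ssval x ^+ (q ^ i).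
  by rewrite -iter_f; split=> [->|/val_inj].
pose h (x : T) := Phi q n (affine_pt (ssval x)).
have card_fix (i : 'I_n) : #|[set x : T | iter i f x == x]| = (q ^ gcdn i n)%N.
  have [|ts [ts_uniq sz_ts tsP]] := roots_fix (gcdn i n).
    by rewrite gcdn_gt0 n_gt0 orbT.
  rewrite -sz_ts cardE -(size_map (@ssval _ rs)).
  apply/perm_size/uniq_perm => // [|z].
    by rewrite map_inj_uniq ?enum_uniq //; exact: val_inj.
  (* T already contains all roots of 'X^(q^g) - 'X, as g divides n. *)
  apply/mapP/idP => [[x] | ].
    rewrite mem_enum inE => /eqP/esym/iter_f_eq xi ->.
    by rewrite tsP; apply/eqP/expr_fix_gcdn.
  rewrite tsP => /eqP/expr_fix_gcdn[z_i /eqP]; rewrite -rsP => z_rs.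
  by exists (SeqSub z_rs) => //; rewrite mem_enum inE; apply/eqP/esym/iter_f_eq.
rewrite -(eq_bigr _ (fun i _ => card_fix i)).
rewrite (sum_card_fix_iter (h := h) n_gt0); last first.
- move=> x y; rewrite Phi_affine_eqP frob_poly_orbit //.
  by split=> -[i ltin /iter_f_eq e]; exists i => //; apply/iter_f_eq.
- by move=> x; apply/esym/iter_f_eq; rewrite T_fix.
rewrite -mulSn /num_rational_points; congr (_ * _)%N.
have -> : rational_points iota (curveB K q n)
    = [set` (Phi q n (infty_pt K) |` [fset h x | x in T])%fset]%classic.
  apply/seteqP; split=> [y [[x _ <-]]|y].
    have [-> _|[s ->] /Phi_affine_rational/eqP] := projline_cases x.
      by rewrite /= fset1U1.
    rewrite -rsP => s_rs; rewrite /= in_fset1U; apply/orP; right.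
    by apply/imfsetP; exists (SeqSub s_rs).
  rewrite /= in_fset1U => /orP[/eqP->|/imfsetP[x _ ->]]; split.
  - by exists (infty_pt K).
  - exact: Phi_infty_rational.
  - by exists (affine_pt (ssval x)).
  - exact/Phi_affine_rational.
rewrite set_fsetK cardfsU1; case: imfsetP => // -[x _ /esym].
by move/(Phi_infty_neq n_gt0).
Qed.

Theorem theorem6p6 (F : finFieldType) (q : nat) (hq : #|F| = q)
    (K : closedFieldType) (iota : {rmorphism F -> K})
    (hK : is_algebraic_closure iota) (n : nat) (hn : (1 <= n)%N) :
  (num_rational_points iota (curveB K q n))%:R =
    n%:R^-1 * q%:R ^+ n
    + \sum_(d <- divisors n | d != n)
        d%:R^-1 * (\prod_(l <- primes (n %/ d)) (1 - l%:R^-1)) * q%:R ^+ d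
    + 1 :> rat.
Proof.
have n_nz : n%:R != 0 :> rat by rewrite pnatr_eq0 -lt0n.
have := congr1 (fun m => m%:R : rat) (num_rational_points_curveB iota hn).
rewrite hq sum_exp_gcdn // natrM natrD natr_sum => NE.
apply: (mulIf n_nz); rewrite NE !mulrDl mul1r addrC; congr (_ + _).
rewrite (bigD1_seq n) ?divisors_uniq -?dvdn_divisors //= divnn hn mul1n natrX.
congr (_ + _); first by rewrite mulrAC mulVf // mul1r.
rewrite mulr_suml big_seq_cond [RHS]big_seq_cond; apply: eq_bigr => d /andP[].
rewrite -dvdn_divisors // => d_n _.
have nd_gt0 : (0 < n %/ d)%N by rewrite divn_gt0 ?(dvdn_gt0 hn) // dvdn_leq.
have -> : n%:R = (n %/ d)%:R * d%:R :> rat by rewrite -natrM divnK.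
rewrite natrM natrX totient_prod //.
have d_nz : d%:R != 0 :> rat by rewrite pnatr_eq0 -lt0n (dvdn_gt0 hn).
by field.
Qed.
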